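(* Let $S$ be an inverse semigroup with $0$ and $1$, and let $\Phi\subset E(S)$ be a set of mutually equivalent non-zero idempotents. Then $S_\Phi$ is an inverse semigroup (with the operations of $S$).
   Context: $E(S)$ is the set of idempotents of $S$, and $s^*$ is the unique pseudoinverse of $s\in S$ ($ss^*s=s$, $s^*ss^*=s^*$). Idempotents $e,f$ are equivalent if there is $s\in S$ with $ss^*=e$ and $s^*s=f$. $S(\Phi)$ is the set of all $s\in S$ such that for every $e\in\Phi$ one of the following holds: either $es^*s=0$; or $es^*s=e$ and then there exists $f\in\Phi$ such that $se=fs$ and $fss^*=f$. Put $S_\Phi=S(\Phi)\cap S(\Phi)^*$, where $R^*=\{s^*:s\in R\}$ for $R\subset S$. *)

(* Defs.v *)
From HB Require Import structures.
From mathcomp Require Import all_boot.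
From mathcomp Require Import boolp classical_sets.

Set Implicit Arguments.
Unset Strict Implicit.
Unset Printing Implicit Defensive.

Local Open Scope classical_set_scope.
Local Open Scope group_scope.

Definition pseudoinverse (T : Type) (mul : T -> T -> T) (s t : T) : Prop :=
  mul (mul s t) s = s /\ mul (mul t s) t = t.

(* [unique P x] is the Stdlib predicate "[x] satisfies [P], and nothing else
   does". *)
Definition unique_pseudoinverse (T : Type) (mul : T -> T -> T)
    (star : T -> T) : Prop :=
  forall s, unique (pseudoinverse mul s) (star s).

(* Unbundled notion, used for operations on subsets of a semigroup, where the
   operations are only available once stability has been established. *)
Definition is_inverse_semigroup (T : Type) (mul : T -> T -> T)
    (star : T -> T) : Prop :=
  associative mul /\ unique_pseudoinverse mul star.

HB.mixin Record Semigroup_isInverse S of Semigroup S := {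
  star : S -> S;
  starP : unique_pseudoinverse (@mul S) star
}.

#[short(type="inverseSemigroupType")]
HB.structure Definition InverseSemigroup :=
  {S of Semigroup_isInverse S & Semigroup S}.

HB.mixin Record Semigroup_hasZero S of Semigroup S := {
  gzero : S;
  mul0g : left_zero gzero (@mul S);
  mulg0 : right_zero gzero (@mul S)
}.

(* Inverse semigroups with 0 and 1; 0 = 1 is not excluded. *)
#[short(type="inverseMonoid0Type")]
HB.structure Definition InverseMonoid0 :=
  {S of Semigroup_isInverse S & Semigroup_hasZero S & Monoid S}.

Notation "s ^*" := (star s) : group_scope.
Notation "0" := gzero : group_scope.

Section Idempotents.
Variable S : inverseSemigroupType.

Definition idempotents : set S := [set e | e * e = e].

Definition idem_equiv (e f : S) : Prop :=
  exists s : S, s * s^* = e /\ s^* * s = f.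

End Idempotents.

Section SPhi.
Variables (S : inverseMonoid0Type) (Phi : set S).

Definition S_of : set S := [set s | forall e, Phi e ->
  e * s^* * s = 0 \/
  (e * s^* * s = e /\
   exists2 f, Phi f & s * e = f * s /\ f * s * s^* = f)].

Definition S_sub : set S := S_of `&` (@star S @` S_of).

End SPhi.

Section InducedOperations.
Variables (S : inverseSemigroupType) (A : set S).

Definition mul_stable : Prop := forall s t, A s -> A t -> A (s * t).
Definition star_stable : Prop := forall s, A s -> A s^*.

Definition sub_mul (hM : mul_stable) (x y : A) : A :=
  SigSub (mem_set (hM _ _ (set_valP x) (set_valP y))).

Definition sub_star (hV : star_stable) (x : A) : A :=
  SigSub (mem_set (hV _ (set_valP x))).

(* [A] is an inverse semigroup with the operations of [S]: they restrict to
   [A], and the restrictions make the type of elements of [A] an inverse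
   semigroup. *)
Definition inverse_subsemigroup : Prop :=
  exists (hM : mul_stable) (hV : star_stable),
    is_inverse_semigroup (sub_mul hM) (sub_star hV).

End InducedOperations.

(* Main.v *)
Require Import Defs.
From HB Require Import structures.
From mathcomp Require Import all_boot.
From mathcomp Require Import boolp classical_sets.

Local Open Scope classical_set_scope.
Local Open Scope group_scope.

(** An element [s] of [S_of Phi] acts on [Phi] as a partial map: it kills [e]
    when [e * s^* * s = 0], and otherwise carries [e] to the idempotent [f]
    of [Phi] with [s * e = f * s].  Such maps compose: if [t] carries [e] to
    [f] and [s] carries [f] to [g], then [s * t] carries [e] to [g]; if [t]
    kills [e], or carries it to an idempotent killed by [s], then [s * t]
    kills [e].  So [S_of Phi] is stable under products ([S_of_mul]).  Since
    the star is an involutive anti-automorphism ([starK], [starM]), the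
    intersection of [S_of Phi] with its image under the star is stable under
    products and the star, and a subset stable under both inherits existence
    and uniqueness of pseudoinverses from [S]
    ([stable_inverse_subsemigroup]). *)

Section InverseSemigroupTheory.
Set Implicit Arguments.
Unset Strict Implicit.
Variable S : inverseSemigroupType.
Implicit Types s t e f : S.

Lemma mul_star_mul s : s * s^* * s = s.
Proof. by case: (starP s) => -[]. Qed.

Lemma star_mul_star s : s^* * s * s^* = s^*.
Proof. by case: (starP s) => -[]. Qed.

Lemma star_uniq s t : s * t * s = s -> t * s * t = t -> s^* = t.
Proof. by move=> sts tst; case: (starP s) => _; apply; split. Qed.

Lemma starK s : s^*^* = s.
Proof. by apply: star_uniq; [exact: star_mul_star | exact: mul_star_mul]. Qed.

Lemma star_idem e : e * e = e -> e^* = e.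
Proof. by move=> ee; apply: star_uniq; rewrite !ee. Qed.

Lemma star_mul_idem s : s^* * s * (s^* * s) = s^* * s.
Proof. by rewrite mulgA star_mul_star. Qed.

Lemma mul_star_idem s : s * s^* * (s * s^*) = s * s^*.
Proof. by rewrite mulgA mul_star_mul. Qed.

(** With [x] the pseudoinverse of [e * f], the element [f * x * e] is another
    one, hence equals [x]; this form makes [x] idempotent, so [x] is its own
    pseudoinverse and [e * f = x]. *)
Lemma idem_mul e f : e * e = e -> f * f = f -> e * f * (e * f) = e * f.
Proof.
move=> ee ff; set x := (e * f)^*.
have efx : e * f * x * (e * f) = e * f by exact: mul_star_mul.
have xef : x * (e * f) * x = x by exact: star_mul_star.
have fxe : x = f * x * e.
  apply: star_uniq.
    by rewrite -[RHS]efx !mulgA -[e * f * f]mulgA ff -[_ * e * e]mulgA ee.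
  rewrite -[in RHS]xef !mulgA -[_ * e * e]mulgA ee.
  by rewrite -[_ * f * f]mulgA ff.
have xx : x * x = x.
  by rewrite {1 2}fxe [RHS]fxe -[in RHS]xef !mulgA.
by have -> : e * f = x by rewrite -[LHS]starK -/x star_idem.
Qed.

(** Both [e * f] and [f * e] are pseudoinverses of [e * f]. *)
Lemma idem_comm e f : e * e = e -> f * f = f -> e * f = f * e.
Proof.
move=> ee ff; have efef := idem_mul ee ff; have fefe := idem_mul ff ee.
rewrite -[LHS](star_idem efef); apply: star_uniq.
  by rewrite -[in RHS]efef !mulgA -[e * f * f]mulgA ff -[_ * e * e]mulgA ee.
by rewrite -[in RHS]fefe !mulgA -[f * e * e]mulgA ee -[_ * f * f]mulgA ff.
Qed.

(** The idempotents [t * t^*] and [s^* * s] meet in the middle of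
    [s * t * t^* * s^* * s * t]; commuting them makes both factors collapse. *)
Lemma starM s t : (s * t)^* = t^* * s^*.
Proof.
have comm := idem_comm (mul_star_idem t) (star_mul_idem s).
apply: star_uniq.
  transitivity (s * (t * t^* * (s^* * s)) * t); first by rewrite !mulgA.
  by rewrite comm !mulgA mul_star_mul -!mulgA (mulgA t) mul_star_mul.
transitivity (t^* * (s^* * s * (t * t^*)) * s^*); first by rewrite !mulgA.
by rewrite -comm !mulgA star_mul_star -!mulgA (mulgA s^*) star_mul_star.
Qed.

Lemma stable_inverse_subsemigroup (A : set S) :
  mul_stable A -> star_stable A -> inverse_subsemigroup A.
Proof.
move=> hM hV; exists hM, hV; split.
  by move=> x y z; apply: val_inj; exact: mulgA.
move=> x; split.
  by split; apply: val_inj; [exact: mul_star_mul | exact: star_mul_star].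
move=> y [/(congr1 val) xyx /(congr1 val) yxy].
by apply: val_inj; exact: star_uniq xyx yxy.
Qed.

End InverseSemigroupTheory.

Section StabilityOfSPhi.
Set Implicit Arguments.
Unset Strict Implicit.
Variables (S : inverseMonoid0Type) (Phi : set S).
Hypothesis Phi_idem : Phi `<=` @idempotents S.

Lemma S_of_mul : mul_stable (S_of Phi).
Proof.
move=> s t Ss St e Pe; rewrite starM !mulgA.
have [et0|[ete [f Pf [te_ft ftt]]]] := St _ Pe.
  by left; rewrite -[t^*]star_mul_star !mulgA et0 !mul0g.
(* the star of t * e = f * t: this moves e across t^* *)
have et_tf : e * t^* = t^* * f.
  have := congr1 (@star S) te_ft.
  by rewrite !starM (star_idem (Phi_idem Pe)) (star_idem (Phi_idem Pf)).
have [fs0|[fsf [g Pg [sf_gs gss]]]] := Ss _ Pf.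
  left; rewrite et_tf.
  transitivity (t^* * (f * s^* * s) * t); first by rewrite !mulgA.
  by rewrite fs0 mulg0 mul0g.
right; split.
  rewrite et_tf.
  transitivity (t^* * (f * s^* * s) * t); first by rewrite !mulgA.
  by rewrite fsf -et_tf.
exists g => //; split.
  by rewrite -mulgA te_ft mulgA sf_gs !mulgA.
rewrite !mulgA -sf_gs.
transitivity (s * (f * t * t^*) * s^*); first by rewrite !mulgA.
by rewrite ftt sf_gs.
Qed.

Lemma S_sub_mul : mul_stable (S_sub Phi).
Proof.
move=> s t [Ss [s' Ss' s's]] [St [t' St' t't]]; split; first exact: S_of_mul.
by exists (t' * s'); [exact: S_of_mul | rewrite starM s's t't].
Qed.

Lemma S_sub_star : star_stable (S_sub Phi).
Proof.
move=> s [Ss [s' Ss' s's]]; split; last by exists s.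
by rewrite -s's starK.
Qed.

End StabilityOfSPhi.

Theorem lemma2p1 (S : inverseMonoid0Type) (Phi : set S)
    (Phi_idem : Phi `<=` @idempotents S)
    (Phi_neq0 : forall e : S, Phi e -> e <> 0)
    (Phi_equiv : forall e f : S, Phi e -> Phi f -> idem_equiv e f) :
  inverse_subsemigroup (S_sub Phi).
Proof.
exact: stable_inverse_subsemigroup (S_sub_mul Phi_idem) (@S_sub_star S Phi).
Qed.
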